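(* Let $0<\beta<1+O(n^{-1/2})$ and write $\beta=1-\delta$. Consider the normalized magnetization chain $(S_t)$ of the Glauber dynamics for the mean-field Ising model on $n$ vertices, started from an arbitrary state $s_0$, and let $\tau_0=\min\{t:|S_t|\le n^{-1}\}$. For $\gamma>0$ define $$t_n(\gamma)=\begin{cases}\frac{n}{2\delta}\log(\delta^2n)+(\gamma+3)\frac n\delta, & \text{if }\delta^2n\to\infty,\\[2pt] \big(200+6\gamma(1+6\sqrt{\delta^2n})\big)n^{3/2}, & \text{if }\delta^2n=O(1).\end{cases}$$ Then there exists a constant $c>0$ such that $\mathbb{P}_{s_0}(\tau_0>t_n(\gamma))\le c/\sqrt{\gamma}$ for all $\gamma>0$, all starting states $s_0$ and all sufficiently large $n$.
   Context: For $n\ge1$ and $\beta\ge0$, the mean-field Ising measure on $\{1,-1\}^n$ is $\mu_n(\sigma)\propto\exp\big(\frac{\beta}{n}\sum_{x<y}\sigma(x)\sigma(y)\big)$; the heat-bath Glauber dynamics chooses a uniform vertex and resamples its spin from $\mu_n$ conditioned on the other spins. The normalized magnetization chain $S_t=\frac1n\sum_iX_t(i)$ is a Markov chain on $\{-1,-1+\frac2n,\dots,1\}$ with $P(s,s-\frac2n)=\frac{1+s}{2}\cdot\frac{1-\tanh(\beta(s-1/n))}{2}$, $P(s,s+\frac2n)=\frac{1-s}{2}\cdot\frac{1+\tanh(\beta(s+1/n))}{2}$, and remaining mass on $P(s,s)$. Here $\delta=\delta(n)$ is a sequence, and the two cases refer to its asymptotic behaviour. *)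

(* Defs.v *)
From HB Require Import structures.
From mathcomp Require Import all_boot all_order all_algebra.
From mathcomp Require Import reals.
From mathcomp Require Import sequences.
From mathcomp.analysis Require Import exp.
Import Order.TTheory GRing.Theory Num.Theory.
Local Open Scope ring_scope.

Section Defs.
Variable R : realType.

Definition tanhR (x : R) : R := (expR x - expR (- x)) / (expR x + expR (- x)).

Definition magn (n : nat) (k : 'I_n.+1) : R := (2 * (k : nat)%:R - n%:R) / n%:R.

Definition p_down (n : nat) (beta s : R) : R :=
  (1 + s) / 2 * ((1 - tanhR (beta * (s - n%:R^-1))) / 2).
Definition p_up (n : nat) (beta s : R) : R :=
  (1 - s) / 2 * ((1 + tanhR (beta * (s + n%:R^-1))) / 2).

Definition magn_trans (n : nat) (beta : R) (i j : 'I_n.+1) : R :=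
  let s := magn n i in
  if (j : nat).+1 == i then p_down n beta s
  else if (j : nat) == (i : nat).+1 then p_up n beta s
  else if j == i then 1 - p_down n beta s - p_up n beta s
  else 0.

(* P_{s0}( |S_t| > 1/n for all t = 0..T ), i.e. P_{s0}(tau_0 > T),
   as a sum over trajectories (x_0, ..., x_T) with x_0 = s0 *)
Definition tail_nat (n : nat) (beta : R) (s0 : 'I_n.+1) (T : nat) : R :=
  \sum_(x : {ffun 'I_T.+1 -> 'I_n.+1} |
        (x ord0 == s0) && [forall t : 'I_T.+1, n%:R^-1 < `|magn n (x t)|])
    \prod_(t < T) magn_trans n beta (x (inord t)) (x (inord t.+1)).

(* P_{s0}(tau_0 > t) for real time t; tau_0 is integer-valued *)
Definition tail_prob (n : nat) (beta : R) (s0 : 'I_n.+1) (t : R) : R :=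
  if t < 0 then 1 else tail_nat n beta s0 (Num.truncn t).

Definition t_n_case1 (delta : nat -> R) (n : nat) (gamma : R) : R :=
  n%:R / (2 * delta n) * ln (delta n ^+ 2 * n%:R) + (gamma + 3) * (n%:R / delta n).

Definition t_n_case2 (delta : nat -> R) (n : nat) (gamma : R) : R :=
  (200 + 6 * gamma * (1 + 6 * Num.sqrt (delta n ^+ 2 * n%:R))) * (n%:R * Num.sqrt n%:R).

End Defs.

Arguments tanhR {R} x.
Arguments magn {R} n k.
Arguments p_down {R} n beta s.
Arguments p_up {R} n beta s.
Arguments magn_trans {R} n beta i j.
Arguments tail_nat {R} n beta s0 T.
Arguments tail_prob {R} n beta s0 t.
Arguments t_n_case1 {R} delta n gamma.
Arguments t_n_case2 {R} delta n gamma.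

(* Main.v *)
Require Import Defs.
From HB Require Import structures.
From mathcomp Require Import all_boot all_order all_algebra.
From mathcomp Require Import reals ring lra zify.
From mathcomp Require Import sequences.
From mathcomp.analysis Require Import topology normedtype derive exp.
Import Order.TTheory GRing.Theory Num.Theory.
Import numFieldNormedType.Exports.
Local Open Scope ring_scope.

(** The tail of the hitting time is an iterate of the kernel Q of the walk killed
    at |s| <= 1/n, applied to 1, and is bounded with two Lyapunov functions of |s|.
    The drift of |s| is at most (tanh (beta s) - s) / n, and
    tanh y <= y / (1 + y^2/4) keeps its cubic part.
    - h(s) = s / sqrt (1 + a s^2) is concave, so only the drift matters, and it
      is exactly multiplied by exp (- t) along the ODE s' = - s (1 + a s^2): it
      captures the linear and the cubic regime of the drift together.
    - e(s) = 1 - exp (- k s) is strictly concave near 0 at scale 1/k, where the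
      noise dominates the drift.
    A combination f of both satisfies Q f <= f - 1, which bounds the expected
    hitting time, and Markov's inequality gives a tail O(1/gamma).
    If delta^2 n tends to infinity then moreover Q h <= (1 - delta/n) h, so that
    after time n/(2 delta) log (delta^2 n) the mean of h, hence of f, is so small
    that the remaining expected time is O(n/delta).
    If delta^2 n = O(1) then f = O(n^(3/2)) from every starting state. *)

(** The function [x / sqrt (1 + a * x^2)] is concave on [x >= 0] with derivative
    [(1 + a * x^2)^(-3/2)], so it lies below its tangent at [s]. After clearing denominators and
    squaring, the gap is a sum of two nonnegative terms divisible by [(u - s)^2]. *)
Lemma concave_tangent (R : rcfType) (a s u : R) : 0 <= a -> 0 <= s -> 0 <= u ->
  u / Num.sqrt (1 + a * u ^+ 2) <=
  s / Num.sqrt (1 + a * s ^+ 2) + (u - s) / Num.sqrt (1 + a * s ^+ 2) ^+ 3.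
Proof.
move=> a0 s0 u0.
have P0 : 0 < 1 + a * s ^+ 2 by have := sqr_ge0 s; nra.
have Q0 : 0 < 1 + a * u ^+ 2 by have := sqr_ge0 u; nra.
set p := Num.sqrt (1 + a * s ^+ 2); set q := Num.sqrt (1 + a * u ^+ 2).
have p0 : 0 < p by rewrite sqrtr_gt0.
have q0 : 0 < q by rewrite sqrtr_gt0.
have pE : p ^+ 2 = 1 + a * s ^+ 2 by rewrite sqr_sqrtr// ltW.
have qE : q ^+ 2 = 1 + a * u ^+ 2 by rewrite sqr_sqrtr// ltW.
have -> : s / p + (u - s) / p ^+ 3 = (a * s ^+ 3 + u) / p ^+ 3.
  have -> : a * s ^+ 3 = s * (p ^+ 2 - 1) by rewrite pE; ring.
  by field; exact: lt0r_neq0.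
have c0 : 0 <= a * s ^+ 3 + u by rewrite addr_ge0// mulr_ge0// exprn_ge0.
rewrite ler_pdivrMr// mulrAC ler_pdivlMr ?exprn_gt0//.
rewrite -(@ler_pXn2r _ 2)// ?nnegrE; last 2 first.
- by rewrite mulr_ge0// exprn_ge0// ltW.
- by rewrite mulr_ge0// ltW.
rewrite !exprMn pE qE -subr_ge0.
have -> : (a * s ^+ 3 + u) ^+ 2 * (1 + a * u ^+ 2) - u ^+ 2 * ((1 + a * s ^+ 2) * ((1 + a * s ^+ 2) * (1 + a * s ^+ 2))) =
  a * u * (u - s) ^+ 2 * (u + 2 * s) + a ^+ 2 * s ^+ 3 * (u - s) ^+ 2 * (s + 2 * u).
  by ring.
have su : 0 <= u + 2 * s by lra.
have us : 0 <= s + 2 * u by lra.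
have := sqr_ge0 (u - s); set e := (u - s) ^+ 2 => e0.
have e1 : 0 <= a * u * e * (u + 2 * s) by rewrite mulr_ge0// mulr_ge0// mulr_ge0.
have e2 : 0 <= a ^+ 2 * s ^+ 3 * e * (s + 2 * u).
  by rewrite mulr_ge0// mulr_ge0// mulr_ge0// exprn_ge0.
exact: addr_ge0.
Qed.

(** * Elementary bounds on the hyperbolic tangent *)

Section tanh.
Variable R : realType.
Implicit Types x y b : R.

Lemma tanhRE x : tanhR x = 1 - 2 / (expR (2 * x) + 1).
Proof.
have E0 := expR_gt0 x.
rewrite /tanhR expRN (_ : 2 * x = x + x) ?expRD; last by ring.
have h1 : expR x * expR x + 1 != 0 by apply: lt0r_neq0; nra.
have h2 : expR x + (expR x)^-1 != 0 by apply: lt0r_neq0; rewrite addr_gt0 ?invr_gt0.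
field.
by rewrite h1 lt0r_neq0//=.
Qed.

Lemma tanhR_ltN1 x : -1 < tanhR x.
Proof.
rewrite tanhRE; have h := expR_gt0 (2 * x).
have : 2 / (expR (2 * x) + 1) < 2 by rewrite ltr_pdivrMr; lra.
lra.
Qed.

Lemma tanhR_lt1 x : tanhR x < 1.
Proof.
rewrite tanhRE; have h := expR_gt0 (2 * x).
have : 0 < 2 / (expR (2 * x) + 1) by rewrite divr_gt0//; lra.
lra.
Qed.

Lemma tanhRN x : tanhR (- x) = - tanhR x.
Proof. by rewrite /tanhR opprK -mulNr opprB [expR (- x) + expR x]addrC. Qed.

Lemma tanhR_le x y : x <= y -> tanhR x <= tanhR y.
Proof.
move=> xy; rewrite !tanhRE lerB// ler_pM2l// lef_pV2 ?posrE; last 2 first.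
- by rewrite addr_gt0// expR_gt0.
- by rewrite addr_gt0// expR_gt0.
by rewrite lerD2r ler_expR ler_pM2l.
Qed.

(** Handles the shifts by [1/n] inside the jump rates. Since [x - b] may be negative, concavity on
    the half-line does not suffice; with [E = exp (2 * x)] and [H = exp (2 * b)] the gap is [E - 1]
    times a nonnegative factor. *)
Lemma tanhR_midpoint x b : 0 <= x -> tanhR (x + b) + tanhR (x - b) <= 2 * tanhR x.
Proof.
move=> x0; rewrite !tanhRE mulrDr mulrBr !expRD expRN.
have E1 : 1 <= expR (2 * x) by rewrite -[leLHS]expR0 ler_expR mulr_ge0.
set E := expR (2 * x) in E1 *; have H0 := expR_gt0 (2 * b).
set H := expR (2 * b) in H0 *.
have E0 : 0 < E by lra.
rewrite -subr_ge0.
have -> : 2 * (1 - 2 / (E + 1)) - (1 - 2 / (E * H + 1) + (1 - 2 / (E / H + 1))) =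
  2 * (E * (E - 1) * (H - 1) ^+ 2 / ((E + 1) * (E * H + 1) * (E + H))).
  by field; rewrite !lt0r_neq0//; nra.
have EH : 0 < E * H by rewrite mulr_gt0.
apply: mulr_ge0 => //; apply: divr_ge0.
  by have := sqr_ge0 (H - 1); set e := _ ^+ 2 => e0; rewrite mulr_ge0//; nra.
have ? : 0 < E * H + 1 by lra.
have ? : 0 < E + H by lra.
by rewrite mulr_ge0// ?mulr_ge0//; lra.
Qed.

(** The Padé bound [exp y <= (2 + y) / (2 - y)], multiplied out so that it also makes sense for
    [y >= 2]. The function [(2 - z) * exp z - z] has derivative [(1 - z) * exp z - 1], which is
    nonpositive by [1 - z <= exp (- z)]. *)
Lemma expR_pade y : 0 <= y -> (2 - y) * expR y <= 2 + y.
Proof.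
rewrite le_eqVlt => /predU1P[<-|y0]; first by rewrite subr0 addr0 expR0 mulr1.
pose f (z : R) := (2 - z) * expR z - z.
have df (z : R) : is_derive z 1 f ((1 - z) * expR z - 1).
  by apply: is_derive_eq; rewrite /GRing.scale/=; ring.
have [|z _] := @MVT R f (fun z => (1 - z) * expR z - 1) 0 y y0 (fun z _ => df z).
  apply: continuous_subspaceT => z.
  exact/differentiable_continuous/derivable1_diffP.
rewrite /f !subr0 expR0 mulr1 => fy.
suff : ((1 - z) * expR z - 1) * y <= 0 by lra.
rewrite pmulr_lle0// ?subr_le0.
by rewrite -ler_pdivlMr ?expR_gt0// div1r -expRN expR_ge1Dx.
Qed.

(** The value of tanh is increasing in [exp (2 * y)], and inserting the square of the Padé bound for
    [exp y] gives exactly [4 * y / (4 + y^2)]. *)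
Lemma tanhR_pade y : 0 <= y -> y < 2 -> tanhR y <= y / (1 + y ^+ 2 / 4).
Proof.
move=> y0 y2; have h := expR_pade _ y0.
have E0 := expR_gt0 y; have Q0 : 0 < 4 + y ^+ 2 by nra.
rewrite tanhRE (_ : 2 * y = y + y) ?expRD; last by ring.
rewrite -subr_ge0.
have -> : y / (1 + y ^+ 2 / 4) - (1 - 2 / (expR y * expR y + 1)) =
  ((2 + y) ^+ 2 - ((2 - y) * expR y) ^+ 2) / ((4 + y ^+ 2) * (expR y ^+ 2 + 1)).
  have EE : 0 < expR y * expR y + 1 by rewrite addr_gt0// mulr_gt0.
  by field; rewrite !lt0r_neq0.
have EE : 0 < expR y ^+ 2 + 1 by rewrite addr_gt0// exprn_gt0.
rewrite divr_ge0//; last by rewrite ltW// mulr_gt0.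
rewrite subr_ge0 ler_pXn2r// nnegrE; last by lra.
by rewrite mulr_ge0// ?ltW//; lra.
Qed.

End tanh.

(** * The tail of the hitting time as an iterate of the killed kernel *)

Section chain.
Variables (R : realType) (n : nat) (beta : R).
Implicit Types (s : R) (i j : 'I_n.+1) (f g : 'I_n.+1 -> R).

Definition alive i : bool := n%:R^-1 < `|magn n i : R|.

(** Killing happens on arrival: the indicator tests [j], never the starting state [i]. *)
Definition killed f i : R :=
  \sum_(j : 'I_n.+1) magn_trans n beta i j * ((alive j)%:R * f j).


(** The Markov property at the first step: the sum over trajectories factors through the state at
    time 1. *)
Lemma tail_natS i T : tail_nat n beta i T.+1 =
  (alive i)%:R * \sum_j magn_trans n beta i j * tail_nat n beta j T.
Proof.
pose A (T : nat) (x : {ffun 'I_T.+1 -> 'I_n.+1}) := [forall t, alive (x t)].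
pose W (T : nat) (x : {ffun 'I_T.+1 -> 'I_n.+1}) : R :=
  \prod_(t < T) magn_trans n beta (x (inord t)) (x (inord t.+1)).
transitivity ((alive i)%:R * \sum_(x | A T x) magn_trans n beta i (x ord0) * W T x).
  (* A trajectory is the same as its first state together with the remaining ones; the sum is
     reindexed along this bijection. *)
  pose cons (p : 'I_n.+1 * {ffun 'I_T.+1 -> 'I_n.+1}) : {ffun 'I_T.+2 -> 'I_n.+1} :=
    [ffun t => oapp p.2 p.1 (unlift ord0 t)].
  have cons0 p : cons p ord0 = p.1 by rewrite ffunE unlift_none.
  have consS p t : cons p (lift ord0 t) = p.2 t by rewrite ffunE liftK.
  rewrite /tail_nat (reindex cons); last first.
    exists (fun x : {ffun 'I_T.+2 -> 'I_n.+1} => (x ord0, [ffun t => x (lift ord0 t)]))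
      => [[j x] _|x _].
      by rewrite cons0; congr pair; apply/ffunP => t; rewrite ffunE consS.
    apply/ffunP => t; case: (unliftP ord0 t) => [u ->|->].
      by rewrite consS ffunE.
    by rewrite cons0.
  rewrite (eq_bigl (fun p => (p.1 == i) && (alive p.1 && A T p.2))); last first.
    move=> p; rewrite cons0; congr andb; apply/forallP/andP => [h|[h /forallP h' t]].
      split; first by have := h ord0; rewrite cons0.
      by apply/forallP => t; have := h (lift ord0 t); rewrite consS.
    by case: (unliftP ord0 t) => [u ->|->]; rewrite ?consS ?cons0//; apply: h'.
  under eq_bigr => p _.
    rewrite big_ord_recl/=.
    have -> : inord 0 = ord0 :> 'I_T.+2 by apply: val_inj; rewrite /= inordK.
    have -> : inord 1 = lift ord0 ord0 :> 'I_T.+2.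
      by apply: val_inj; rewrite /= inordK.
    rewrite cons0 consS.
    under eq_bigr => t _.
      rewrite /bump/= add1n.
      have -> : inord t.+1 = lift ord0 (inord t) :> 'I_T.+2.
        by apply: val_inj; rewrite /= /bump/= !inordK ?ltnS// ltnW.
      have -> : inord t.+2 = lift ord0 (inord t.+1) :> 'I_T.+2.
        by apply: val_inj; rewrite /= /bump/= !inordK ?ltnS.
      rewrite !consS.
      over.
    over.
  rewrite -(pair_big_dep (fun j => j == i) (fun j x => alive j && A T x)
    (fun j x => magn_trans n beta j (x ord0) * W T x))/= big_pred1_eq.
  case: (alive i); first by rewrite mul1r.
  by rewrite big_pred0 ?mul0r.
congr (_ * _).
(* The remaining trajectories are grouped by their own first state [j]. *)
rewrite (partition_big (fun x : {ffun 'I_T.+1 -> 'I_n.+1} => x ord0) predT)//=.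
apply: eq_bigr => j _; rewrite /tail_nat big_distrr/=.
apply: eq_big => [x|x /andP[_ /eqP->]]; first by rewrite andbC.
by [].
Qed.

(** Trajectories disappear from here on. The factor [alive i] is the test at time 0, which [killed]
    omits. *)
Lemma tail_natE i T :
  tail_nat n beta i T = (alive i)%:R * iter T killed (fun=> 1) i.
Proof.
elim: T i => [|T IH] i.
  rewrite /= mulr1 /tail_nat; under eq_bigr => x _ do rewrite big_ord0.
  case: (boolP (alive i)) => ai.
    rewrite (big_pred1 [ffun=> i]) => [//|x].
    apply/andP/eqP => [[/eqP x0 _]|->].
      by apply/ffunP => t; rewrite ffunE (ord1 t).
    by split; [rewrite ffunE|apply/forallP => t; rewrite ffunE].
  rewrite big_pred0// => x; apply/negP => /andP[/eqP x0 /forallP/(_ ord0)].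
  by rewrite x0; apply/negP.
by rewrite tail_natS/= {2}/killed; under eq_bigr => j _ do rewrite IH.
Qed.

End chain.

(** * Jump rates: symmetry, drift and a lower bound on the noise *)

Section rates.
Variables (R : realType) (n : nat) (beta : R).
Implicit Types s : R.

Lemma p_downN s : p_down n beta (- s) = p_up n beta s.
Proof. by rewrite /p_down /p_up -opprD mulrN tanhRN opprK. Qed.

Lemma p_upN s : p_up n beta (- s) = p_down n beta s.
Proof. by rewrite -p_downN opprK. Qed.

Lemma p_down_itv s : -1 <= s -> 0 <= p_down n beta s <= (1 + s) / 2.
Proof.
move=> s1; rewrite /p_down.
have := tanhR_lt1 _ (beta * (s - n%:R^-1)); have := tanhR_ltN1 _ (beta * (s - n%:R^-1)).
set T := tanhR _ => T1 T2; apply/andP; split; nra.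
Qed.

Lemma p_up_itv s : s <= 1 -> 0 <= p_up n beta s <= (1 - s) / 2.
Proof. by move=> s1; rewrite -p_downN; apply: p_down_itv; rewrite lerN2. Qed.

Hypothesis beta0 : 0 <= beta.

(** With [T1], [T2] the tanh values at [beta * s] minus and plus [beta / n], the right-hand side
    equals [s - (T1 + T2) / 2 + s * (T2 - T1) / 2]. The last term is nonnegative by monotonicity,
    and the midpoint and Padé bounds control the mean. *)
Lemma drift_ge s : 0 <= s -> beta * s < 2 ->
  s * (1 - beta / (1 + (beta * s) ^+ 2 / 4)) <= 2 * (p_down n beta s - p_up n beta s).
Proof.
move=> s0 bs2; have bs0 : 0 <= beta * s by rewrite mulr_ge0.
have := tanhR_pade _ _ bs0 bs2; have := tanhR_midpoint _ _ (beta / n%:R) bs0.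
have : tanhR (beta * s - beta / n%:R) <= tanhR (beta * s + beta / n%:R).
  apply: tanhR_le; rewrite lerD2l.
  have : 0 <= beta / n%:R by rewrite divr_ge0.
  lra.
rewrite /p_down /p_up (mulrBr beta s) (mulrDr beta s).
have -> : s * (1 - beta / (1 + (beta * s) ^+ 2 / 4)) =
  s - beta * s / (1 + (beta * s) ^+ 2 / 4) by ring.
set X := _ / (1 + _); set T := tanhR (beta * s).
by set T1 := tanhR _; set T2 := tanhR _; nra.
Qed.

Lemma p_down_ge s : 0 <= s -> s <= 1 -> beta <= 5 / 4 -> 1 / 40 <= p_down n beta s.
Proof.
move=> s0 s1 b1.
(* The Padé bound at [5/4] is [80/89], below [9/10]; then [1/40] is [1/2] times [1/20]. *)
have : tanhR (beta * (s - n%:R^-1)) <= 9 / 10.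
  apply: (@le_trans _ _ (tanhR (5 / 4))).
    apply: tanhR_le; apply: (@le_trans _ _ (beta * 1)); last by rewrite mulr1.
    apply: ler_wpM2l => //.
    have : 0 <= n%:R^-1 :> R by rewrite invr_ge0.
    lra.
  by apply: (le_trans (tanhR_pade _ _ _ _)); rewrite ?ler_pdivrMr; lra.
rewrite /p_down; set T := tanhR _ => T9; nra.
Qed.

End rates.

(** * Reduction to functions of [|s|] and comparison principles for the killed kernel *)

Section killed.
Variables (R : realType) (n : nat) (beta : R).
Implicit Types (i j : 'I_n.+1) (f g : 'I_n.+1 -> R) (F : R -> R).

Local Notation d := (2 / n%:R : R).
Local Notation pd := (p_down n beta).
Local Notation pu := (p_up n beta).
Local Notation Q := (killed R n beta).
Local Notation live i := (alive R n i).

(** The unkilled step in a real variable [w], so that the Lyapunov estimates below involve no finite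
    state space. *)
Definition radial_step F (w : R) : R :=
  pu w * F (w + d) + pd w * F (w - d) + (1 - pd w - pu w) * F w.

Hypothesis n0 : (0 < n)%N.

Let n0R : 0 < n%:R :> R. Proof. by rewrite ltr0n. Qed.

Lemma magn_norm_le1 i : `|magn n i : R| <= 1.
Proof.
rewrite /magn normrM normfV (gtr0_norm n0R) ler_pdivrMr// mul1r.
have : (i : nat)%:R <= n%:R :> R by rewrite ler_nat -ltnS.
have := ler0n R i.
by rewrite ler_norml; lra.
Qed.

Lemma alive_ge i : live i -> d <= `|magn n i|.
Proof.
rewrite /alive /magn normrM normfV (gtr0_norm n0R).
rewrite -{1}[n%:R^-1]mul1r ltr_pM2r ?invr_gt0// ler_pM2r ?invr_gt0//.
(* One of the two truncated differences is zero, so [n * |s|] is a natural number; being greater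
   than 1, it is at least 2. *)
have -> : `|2 * (i : nat)%:R - n%:R| = ((2 * i - n) + (n - 2 * i))%N%:R :> R.
  have [ni|ni] := leqP n (2 * i).
    by rewrite (eqP ni) addn0 natrB// natrM ger0_norm// subr_ge0 -natrM ler_nat.
  rewrite (eqP (ltnW ni)) add0n natrB ?(ltnW ni)// natrM distrC ger0_norm//.
  by rewrite subr_ge0 -natrM ler_nat ltnW.
by rewrite ltr1n ler_nat.
Qed.

Lemma magn_trans_ge0 i j : 0 <= magn_trans n beta i j.
Proof.
have := magn_norm_le1 i; rewrite ler_norml => /andP[s1 s2].
have /andP[d0 d1] := p_down_itv _ n beta _ s1.
have /andP[u0 u1] := p_up_itv _ n beta _ s2.
rewrite /magn_trans; do 3 case: ifP => _ //; lra.
Qed.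

(** The end states fit the same formula: at [s = 1] and [s = -1] the outward rate vanishes, so the
    value of [F] outside [[-1, 1]] does not matter. *)
Lemma magn_transE i F : \sum_j magn_trans n beta i j * F (magn n j) =
  pu (magn n i) * F (magn n i + d) + pd (magn n i) * F (magn n i - d) +
  (1 - pd (magn n i) - pu (magn n i)) * F (magn n i).
Proof.
set s := magn n i.
pose e (b : bool) : R := b%:R.
have -> : \sum_j magn_trans n beta i j * F (magn n j) =
  \sum_(j : 'I_n.+1) (e ((j : nat) == i.+1) * (pu s * F (magn n j)) +
    e (j.+1 == i) * (pd s * F (magn n j)) +
    e (j == i) * ((1 - pd s - pu s) * F (magn n j))).
  apply: eq_bigr => j _; rewrite /magn_trans -/s /e.
  have [ji|_] := eqVneq j.+1 i.
    have -> : ((j : nat) == i.+1) = false by lia.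
    have -> : (j == i) = false by rewrite -val_eqE/=; lia.
    by rewrite mul0r mul1r add0r mul0r addr0.
  have [ji|_] := eqVneq (j : nat) i.+1.
    have -> : (j == i) = false by rewrite -val_eqE/=; lia.
    by rewrite !mul0r mul1r !addr0.
  by rewrite !mul0r !add0r; case: (j == i); rewrite ?mul1r ?mul0r.
rewrite !big_split/=; congr (_ + _ + _).
- have [ni|ni] := leqP n i.
    have iE : (i : nat) = n by have := ltn_ord i; lia.
    rewrite big1 => [|j _].
      rewrite /s /magn /p_up iE.
      have -> : 1 - (2 * n%:R - n%:R) / n%:R = 0 :> R by field; exact: lt0r_neq0.
      by rewrite !mul0r.
    have -> : ((j : nat) == i.+1) = false by have := ltn_ord j; lia.
    by rewrite /e mul0r.
  rewrite (bigD1 (inord i.+1))//= inordK ?ltnS// eqxx big1 => [|j jn].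
    rewrite addr0 /e mul1r; congr (_ * F _).
    rewrite /s /magn inordK ?ltnS// -natr1; field; exact: lt0r_neq0.
  have [ji|] := eqVneq (j : nat) i.+1; last by rewrite /e mul0r.
  by move/eqP: jn; case; apply: val_inj; rewrite /= inordK ?ltnS.
- have [i0|i0] := posnP i.
    rewrite big1 => [|j _].
      rewrite /s /magn /p_down i0.
      have -> : 1 + (2 * 0 - n%:R) / n%:R = 0 :> R by field; exact: lt0r_neq0.
      by rewrite !mul0r.
    by rewrite i0 /e mul0r.
  have ii : (i.-1 < n.+1)%N by have := ltn_ord i; lia.
  rewrite (bigD1 (inord i.-1))//= inordK// prednK// eqxx big1 => [|j jn].
    rewrite addr0 /e mul1r; congr (_ * F _).
    rewrite /s /magn inordK// -[in RHS](prednK i0) -natr1; field; exact: lt0r_neq0.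
  have [ji|] := eqVneq j.+1 i; last by rewrite /e mul0r.
  by move/eqP: jn; case; apply: val_inj; rewrite /= inordK// -ji.
- rewrite (bigD1 i)//= eqxx big1 => [|j /negPf ->]; last by rewrite /e mul0r.
  by rewrite addr0 /e mul1r.
Qed.

Lemma killed_le f g i : (forall j, live j -> f j <= g j) -> Q f i <= Q g i.
Proof.
move=> fg; apply: ler_sum => j _; apply: ler_wpM2l; first exact: magn_trans_ge0.
by case: (boolP (live j)) => [/fg|_]; rewrite ?mul0r// !mul1r.
Qed.

Lemma killedZ c f i : Q (fun j => c * f j) i = c * Q f i.
Proof. by rewrite /killed big_distrr; apply: eq_bigr => j _ /=; ring. Qed.

(* An alive state has |s| >= 2/n, so that one step cannot change the sign of s
   and |s - 2/n| = |s| - 2/n on the positive side. *)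
Lemma killed_radial_le F i : (forall x, 0 <= x -> 0 <= F x) -> live i ->
  Q (fun j => F `|magn n j|) i <= radial_step F `|magn n i|.
Proof.
move=> F0 li; set w : R := `|magn n i|; have wE : w = `|magn n i| by [].
rewrite /radial_step.
apply: (@le_trans _ _ (\sum_j magn_trans n beta i j * F `|magn n j|)).
  apply: ler_sum => j _; apply: ler_wpM2l; first exact: magn_trans_ge0.
  by case: (live j); rewrite ?mul1r// mul0r F0.
have dw : d <= w := alive_ge _ li; have d0 : 0 < d by rewrite divr_gt0.
rewrite (magn_transE i (fun s => F `|s|)) -wE.
have wd1 : 0 <= w + d by lra.
have wd2 : 0 <= w - d by rewrite subr_ge0.
have [s0|s0] := leP 0 (magn n i : R).
  have -> : magn n i = w by rewrite wE ger0_norm.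
  by rewrite (ger0_norm wd1) (ger0_norm wd2).
have -> : magn n i = - w by rewrite wE ltr0_norm// opprK.
rewrite p_downN p_upN -opprD [- w + d]addrC !normrN (distrC d w) (ger0_norm wd1) (ger0_norm wd2).
lra.
Qed.

Lemma killed_1_le1 i : Q (fun=> 1) i <= 1.
Proof.
apply: (@le_trans _ _ (\sum_j magn_trans n beta i j * 1)).
  apply: ler_sum => j _; apply: ler_wpM2l; first exact: magn_trans_ge0.
  by case: (live j); rewrite ?mul1r// mul0r.
by rewrite (magn_transE i (fun=> 1)); lra.
Qed.

Lemma iter_killed_le m f g i : live i -> (forall j, live j -> f j <= g j) ->
  iter m Q f i <= iter m Q g i.
Proof.
move=> + fg; elim: m i => [|m IH] i li /=; first exact: fg.
exact: killed_le.
Qed.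

Lemma iter_killed_contract m lambda f i : 0 <= lambda -> live i ->
  (forall j, live j -> Q f j <= lambda * f j) -> iter m Q f i <= lambda ^+ m * f i.
Proof.
move=> l0 + fl; elim: m i => [|m IH] i li /=; first by rewrite mul1r.
apply: (le_trans (killed_le _ (fun j => lambda ^+ m * f j) _ IH)).
by rewrite killedZ exprSr -mulrA ler_wpM2l ?exprn_ge0// fl.
Qed.

Lemma iter_killedZ m c f i :
  iter m Q (fun j => c * f j) i = c * iter m Q f i.
Proof.
elim: m i => [//|m IH] i /=.
rewrite -killedZ; apply: eq_bigr => j _; by rewrite IH.
Qed.

Lemma iter_killed_1_le1 m i : live i -> iter m Q (fun=> 1) i <= 1.
Proof.
elim: m i => [//|m IH] i li /=.
exact: (le_trans (killed_le _ (fun=> 1) _ IH) (killed_1_le1 i)).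
Qed.

(** Markov's inequality for the hitting time, by induction: [u + 1] copies of the new tail are at
    most [Q f] (from the [u] earlier copies) plus 1, hence at most [f]. *)
Lemma iter_killed_hitting u f i : live i ->
  (forall j, live j -> 0 <= f j) -> (forall j, live j -> Q f j <= f j - 1) ->
  u%:R * iter u Q (fun=> 1) i <= f i.
Proof.
move=> + f0 fQ; elim: u i => [|u IH] i li; first by rewrite mul0r f0.
rewrite -natr1 mulrDl mul1r.
have := iter_killed_1_le1 u.+1 _ li; rewrite /= -killedZ.
have := killed_le _ _ i IH; have := fQ _ li.
lra.
Qed.

End killed.

(** * One-step estimates for the two Lyapunov functions *)

Section lyapunov.
Variables (R : realType) (n : nat) (beta : R).
Implicit Types (F : R -> R) (a k w m : R).

Local Notation d := (2 / n%:R : R).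
Local Notation pd := (p_down n beta).
Local Notation pu := (p_up n beta).
Local Notation radial_step := (radial_step R n beta).

(** The function h of the overview, as [expc] is e. It saturates at [1 / sqrt a], which yields
    bounds uniform in the starting state. *)
Definition sat a w : R := w / Num.sqrt (1 + a * w ^+ 2).

Definition expc k w : R := 1 - expR (- (k * w)).

Lemma radial_step_lin b c F G w :
  radial_step (fun x => b * F x + c * G x) w = b * radial_step F w + c * radial_step G w.
Proof. by rewrite /radial_step; ring. Qed.

Lemma sat_ge0 a w : 0 <= w -> 0 <= sat a w.
Proof. by move=> w0; rewrite divr_ge0// sqrtr_ge0. Qed.

Lemma expc_ge0 k w : 0 <= k -> 0 <= w -> 0 <= expc k w.
Proof. by move=> k0 w0; rewrite subr_ge0 expR_le1 oppr_le0 mulr_ge0. Qed.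

Lemma expc_le1 k w : expc k w <= 1.
Proof. by rewrite gerBl expR_ge0. Qed.

Lemma expc_le k w : expc k w <= k * w.
Proof. by have := expR_ge1Dx (- (k * w)); rewrite /expc; lra. Qed.

Hypothesis n0 : (0 < n)%N.

Let d0 : 0 < d. Proof. by rewrite divr_gt0// ltr0n. Qed.

(** The tangent inequality at [w + d] and [w - d]: by concavity the noise can only help, and the
    drift times the derivative remains. The condition [d <= w] keeps both points on the half-line of
    concavity. *)
Lemma sat_step_le a w : 0 <= a -> d <= w -> w <= 1 ->
  radial_step (sat a) w <=
  sat a w - d * (pd w - pu w) / Num.sqrt (1 + a * w ^+ 2) ^+ 3.
Proof.
move=> a0 dw w1; have w0 : 0 <= w := le_trans (ltW d0) dw.
have wN1 : -1 <= w by have := d0; lra.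
have wd1 : 0 <= w + d by have := d0; lra.
have wd2 : 0 <= w - d by rewrite subr_ge0.
have /andP[D0 D1] := p_down_itv R n beta w wN1.
have /andP[U0 U1] := p_up_itv R n beta w w1.
have := concave_tangent R a w (w + d) a0 w0 wd1.
have := concave_tangent R a w (w - d) a0 w0 wd2.
rewrite /radial_step /sat; set p := Num.sqrt (1 + a * w ^+ 2).
set X := _ / Num.sqrt (1 + a * (w - d) ^+ 2); set Y := _ / Num.sqrt (1 + a * (w + d) ^+ 2).
have -> : (w - d - w) / p ^+ 3 = - (d / p ^+ 3) by ring.
have -> : (w + d - w) / p ^+ 3 = d / p ^+ 3 by ring.
have -> : d * (pd w - pu w) / p ^+ 3 = (pd w - pu w) * (d / p ^+ 3) by ring.
set h := w / p; set e := d / _.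
move=> HX HY.
have : pu w * Y <= pu w * (h + e) by apply: ler_wpM2l.
have : pd w * X <= pd w * (h - e) by apply: ler_wpM2l.
lra.
Qed.

Lemma expc_stepE k w : radial_step (expc k) w =
  expc k w - expR (- (k * w)) * (expR (k * d) - 1) * (pd w - pu w / expR (k * d)).
Proof.
rewrite /radial_step /expc.
have -> : - (k * (w + d)) = - (k * w) + - (k * d) by ring.
have -> : - (k * (w - d)) = - (k * w) + k * d by ring.
rewrite !expRD [expR (- (k * d))]expRN.
by field; rewrite gt_eqF ?expR_gt0.
Qed.

(** Here [m] bounds from below the drift plus the noise gain [pd w * (k * d)], which comes from
    [exp (k * d) - 1 >= k * d]. The factor [1/3] pays for dividing by [exp (k * d) <= 3]. *)
Lemma expc_step_le k w m : 0 <= k -> k * d <= 1 -> d <= w -> w <= 1 -> 0 <= m ->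
  m <= pd w - pu w + pd w * (k * d) ->
  radial_step (expc k) w <= expc k w - expR (- (k * w)) * (k * d) * m / 3.
Proof.
move=> k0 kd1 dw w1 m0 mle.
have wN1 : -1 <= w by have := d0; lra.
have /andP[D0 D1] := p_down_itv R n beta w wN1.
have y0 : 0 <= k * d by rewrite mulr_ge0// ltW.
rewrite expc_stepE; have := expR_ge1Dx (k * d); have := expR_pade _ _ y0.
set E := expR (k * d) in mle *; set y := k * d in y0 kd1 mle *.
move=> E1 E2.
have E0 : 0 < E by rewrite expR_gt0.
have E3 : E <= 3 by nra.
have e0 := expR_ge0 (- (k * w)); set e := expR _ in e0 *.
rewrite lerD2l lerN2.
have -> : e * y * m / 3 = e * (y * (m / 3)) by ring.
rewrite -(mulrA e) ler_wpM2l//.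
have -> : pd w - pu w / E = (pd w - pu w + pd w * (E - 1)) / E.
  by field; exact: lt0r_neq0.
rewrite ler_pM// ?divr_ge0//; first by lra.
rewrite ler_pdivlMr// mulrAC ler_pdivrMr//.
apply: (@le_trans _ _ (m * 3)); first by rewrite ler_wpM2l.
rewrite ler_pM2r//; apply: (le_trans mle); rewrite lerD2l ler_wpM2l//; lra.
Qed.

End lyapunov.

Lemma expR_le3 (R : realType) (x : R) : 0 <= x <= 1 -> expR x <= 3.
Proof.
by move=> /andP[x0 x1]; have := expR_pade _ _ x0; have := expR_gt0 x; nra.
Qed.

(** * The case where [delta^2 n] is large *)

Section subcritical.
Variables (R : realType) (n : nat) (dl : R).
Hypothesis n4 : (4 <= n)%N.
Hypothesis dl0 : 0 < dl.
Hypothesis dl1 : dl < 1.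
Hypothesis dln : 1 <= dl ^+ 2 * n%:R.
Implicit Types (w : R) (i j : 'I_n.+1).

Local Notation d := (2 / n%:R : R).
Local Notation pd := (p_down n (1 - dl)).
Local Notation pu := (p_up n (1 - dl)).
Local Notation step := (radial_step R n (1 - dl)).
Local Notation Q := (killed R n (1 - dl)).
Local Notation live i := (alive R n i).
(** [a] is the cubic coefficient of the drift relative to the linear one, with a safety factor;
    [1 / k] is the scale at which the linear drift balances the noise. *)
Let a : R := (1 - dl) ^+ 3 / (5 * dl).
Let k : R := Num.sqrt (dl * n%:R).

Let n0 : (0 < n)%N. Proof. exact: leq_trans n4. Qed.
Let n4R : 4 <= n%:R :> R. Proof. by rewrite ler_nat. Qed.
Let n0R : 0 < n%:R :> R. Proof. by rewrite ltr0n. Qed.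
Let d0 : 0 < d. Proof. by rewrite divr_gt0. Qed.
Let a0 : 0 <= a.
Proof. by rewrite divr_ge0 ?exprn_ge0 ?subr_ge0 ?mulr_ge0// ltW. Qed.
Let k0 : 0 <= k. Proof. exact: sqrtr_ge0. Qed.
Let kE : k ^+ 2 = dl * n%:R. Proof. by rewrite sqr_sqrtr// mulr_ge0// ltW. Qed.

Let p w : R := Num.sqrt (1 + a * w ^+ 2).

Let pE w : p w ^+ 2 = 1 + a * w ^+ 2.
Proof. by rewrite sqr_sqrtr// addr_ge0// mulr_ge0// sqr_ge0. Qed.

Let p_gt0 w : 0 < p w.
Proof. by rewrite sqrtr_gt0 ltr_pwDl// mulr_ge0// sqr_ge0. Qed.

Ltac dlra := move: dl0 dl1 dln n4R; lra.
Ltac dnra := move: dl0 dl1; nra.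

(** With [z = ((1 - dl) * w)^2 / 4], both sides contain [dl * w]. The cubic parts compare [4/5] with
    [1 / (1 + z)], where [z <= 1/4]; this is where the 5 in [a] comes from. *)
Lemma subcritical_drift w : 0 <= w -> w <= 1 ->
  dl * w * p w ^+ 2 <= 2 * (pd w - pu w).
Proof.
move=> w0 w1; have b0 : 0 <= 1 - dl by dlra.
have bw2 : (1 - dl) * w < 2 by dnra.
apply: le_trans (drift_ge _ _ _ b0 _ w0 bw2); rewrite pE.
have b1 : 1 - dl <= 1 by dlra.
set b := 1 - dl in b0 b1 bw2 *; set z := (b * w) ^+ 2 / 4.
have z0 : 0 <= z by rewrite divr_ge0// sqr_ge0.
have z1 : z <= 1 / 4.
  by rewrite ler_pM2r ?invr_gt0// exprn_ile1 ?mulr_ge0// mulr_ile1.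
rewrite mulrAC [leRHS]mulrC ler_wpM2r//.
have -> : dl * (1 + a * w ^+ 2) = dl + b * z * (4 / 5).
  by rewrite /a /z -/b; field; exact: lt0r_neq0.
have -> : 1 - b / (1 + z) = dl + b * z * (1 + z)^-1.
  by rewrite /b; field; apply: lt0r_neq0; dlra.
rewrite lerD2l ler_wpM2l ?mulr_ge0// -[leRHS]div1r ler_pdivlMr; dlra.
Qed.

(** The factor [p w ^+ 2] in the drift cancels against the [p w ^+ 3] of the tangent slope, leaving
    a multiple of [sat] itself. *)
Lemma subcritical_sat_step w : d <= w -> w <= 1 ->
  step (sat R a) w <= (1 - dl / n%:R) * sat R a w.
Proof.
move=> dw w1; have w0 : 0 <= w := le_trans (ltW d0) dw.
apply: (le_trans (sat_step_le _ _ _ n0 _ _ a0 dw w1)).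
rewrite mulrBl mul1r lerD2l lerN2 /sat -/(p w).
have -> : dl / n%:R * (w / p w) = (dl * w * p w ^+ 2) / (n%:R * p w ^+ 3).
  by field; rewrite !lt0r_neq0.
have -> : d * (pd w - pu w) / p w ^+ 3 = (2 * (pd w - pu w)) / (n%:R * p w ^+ 3).
  by field; rewrite !lt0r_neq0.
apply: ler_wpM2r; last exact: subcritical_drift.
by rewrite invr_ge0 ltW// mulr_gt0// exprn_gt0.
Qed.

(** The drift is only used to be inward; the gain is pure noise, [(k * d)^2 / 120] with
    [(k * d)^2 = 4 * dl / n]. *)
Lemma subcritical_expc_step w : d <= w -> w <= 1 ->
  step (expc R k) w <= expc R k w - expR (- (k * w)) * (dl / (30 * n%:R)).
Proof.
move=> dw w1; have w0 : 0 <= w := le_trans (ltW d0) dw.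
have y2 : (k * d) ^+ 2 = 4 * dl / n%:R.
  by rewrite exprMn kE; field; exact: lt0r_neq0.
have kd0 : 0 <= k * d by rewrite mulr_ge0// ltW.
have y1 : k * d <= 1.
  rewrite -(@ler_pXn2r _ 2)// ?nnegrE//.
  rewrite expr1n y2 ler_pdivrMr//; dlra.
have pd40 : 1 / 40 <= pd w by apply: p_down_ge; dlra.
have mu0 : 0 <= pd w - pu w.
  have := subcritical_drift _ w0 w1.
  have : 0 <= dl * w * p w ^+ 2 by rewrite mulr_ge0 ?sqr_ge0// mulr_ge0// ltW.
  dlra.
apply: (le_trans (expc_step_le _ _ _ n0 _ _ (k * d / 40) k0 y1 dw w1 _ _)).
- by rewrite divr_ge0.
- by have : 1 / 40 * (k * d) <= pd w * (k * d) by [exact: ler_wpM2r]; dlra.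
rewrite lerD2l lerN2 le_eqVlt; apply/orP; left; apply/eqP.
rewrite [RHS](_ : _ = expR (- (k * w)) * (k * d) ^+ 2 / 120); first by rewrite y2; field; exact: lt0r_neq0.
by field; exact: lt0r_neq0.
Qed.

Let p_le w : 0 <= w -> p w <= 1 + k * w.
Proof.
move=> w0; have kw0 : 0 <= k * w by rewrite mulr_ge0.
rewrite -(@ler_pXn2r _ 2)// ?nnegrE ?addr_ge0// ?(ltW (p_gt0 w))//.
(* By [dl^2 * n >= 1], the noise scale [1 / k] is at most the scale [1 / sqrt a] of the cubic
   regime. *)
have ak : a <= k ^+ 2.
  rewrite kE /a ler_pdivrMr ?mulr_gt0//.
  have : (1 - dl) ^+ 3 <= 1 by rewrite exprn_ile1//; dlra.
  have : dl * n%:R * (5 * dl) = 5 * (dl ^+ 2 * n%:R) by ring.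
  dlra.
have : a * w ^+ 2 <= k ^+ 2 * w ^+ 2 by rewrite ler_wpM2r// sqr_ge0.
rewrite pE; dnra.
Qed.

(** From [expc <= min (1, k * w)] and [p <= 1 + k * w]. It bounds the whole Lyapunov function by
    [sat], the part that contracts. *)
Lemma expc_le_sat w : 0 <= w -> expc R k w <= 2 * k * sat R a w.
Proof.
move=> w0; rewrite /sat -/(p w) mulrA ler_pdivlMr//.
have kw0 : 0 <= k * w by rewrite mulr_ge0.
have e0 := expc_ge0 _ _ _ k0 w0.
have := expc_le _ k w; have := expc_le1 _ k w; have := p_le _ w0.
set e := expc _ _ _ in e0 *; set P := p w => H1 H2 H3.
have : e * P <= e * (1 + k * w) by rewrite ler_wpM2l.
dnra.
Qed.

(** The first term decreases by [3 * exp (- k * w)], at least 1 if [k * w <= 1]; the second by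
    [2 * k * sat], at least 1 if [k * w >= 1]. *)
Let f w : R := n%:R / dl * 90 * expc R k w + n%:R / dl * (2 * k) * sat R a w.

Lemma subcritical_hitting_step w : d <= w -> w <= 1 -> step f w <= f w - 1.
Proof.
move=> dw w1; have w0 : 0 <= w := le_trans (ltW d0) dw.
have nd0 : 0 < n%:R / dl by rewrite divr_gt0.
rewrite radial_step_lin /f.
have s0 := sat_ge0 _ a _ w0.
have c0 : 0 <= n%:R / dl * 90 by rewrite mulr_ge0// ltW.
have c1 : 0 <= n%:R / dl * (2 * k) by apply: mulr_ge0; [exact: ltW|exact: mulr_ge0].
have := ler_wpM2l c0 (subcritical_expc_step _ dw w1).
have := ler_wpM2l c1 (subcritical_sat_step _ dw w1).
set S := step _ _; set E := step _ _; set e := expR _.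
have -> : n%:R / dl * 90 * (expc R k w - e * (dl / (30 * n%:R))) =
   n%:R / dl * 90 * expc R k w - 3 * e by field; rewrite !lt0r_neq0.
have -> : n%:R / dl * (2 * k) * ((1 - dl / n%:R) * sat R a w) =
   n%:R / dl * (2 * k) * sat R a w - 2 * k * sat R a w by field; rewrite !lt0r_neq0.
have e0 : 0 <= e by exact: expR_ge0.
have ks0 : 0 <= 2 * k * sat R a w by apply: mulr_ge0 => //; exact: mulr_ge0.
suff : 1 <= 3 * e + 2 * k * sat R a w by dlra.
have [kw1|kw1] := leP (k * w) 1.
  have : 1 <= 3 * e; last by dlra.
  rewrite /e expRN ler_pdivlMr ?expR_gt0// mul1r expR_le3// kw1 mulr_ge0//.
have : 1 <= 2 * k * sat R a w; last by dlra.
rewrite /sat -/(p w) mulrA ler_pdivlMr//; have := p_le _ w0; dlra.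
Qed.

(** The saturation level is of order [sqrt dl]. Starting the contraction there and not at 1 is what
    produces [log (delta^2 n)] with the factor [1/2]. *)
Lemma sat_le_sqrt w : 0 <= w -> w <= 1 -> sat R a w <= 3 * Num.sqrt dl.
Proof.
move=> w0 w1; rewrite /sat -/(p w) ler_pdivrMr//.
rewrite -(@ler_pXn2r _ 2)// ?nnegrE ?mulr_ge0 ?sqrtr_ge0 ?(ltW (p_gt0 w))//.
rewrite !exprMn pE sqr_sqrtr ?ltW//.
have -> : 3 ^+ 2 * dl * (1 + a * w ^+ 2) = 9 * dl + 9 / 5 * (1 - dl) ^+ 3 * w ^+ 2.
  by rewrite /a; field; exact: lt0r_neq0.
have w2 : 0 <= w ^+ 2 <= 1 by rewrite sqr_ge0 exprn_ile1.
move: w2; set W := w ^+ 2 => /andP[W0 W1].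
have b3 : 1 - 3 * dl <= (1 - dl) ^+ 3.
  rewrite -subr_ge0 (_ : _ - _ = dl ^+ 2 * (3 - dl)); last by ring.
  by rewrite mulr_ge0 ?sqr_ge0//; dlra.
have b0 : 0 <= (1 - dl) ^+ 3 by rewrite exprn_ge0//; dlra.
move: b3 b0; set b := _ ^+ 3 => b3 b0.
have : W * (1 - 3 * dl) <= W * b by rewrite ler_wpM2l.
have : W * (3 * dl) <= 1 * (3 * dl) by rewrite ler_wpM2r// mulr_ge0// ltW.
have : 0 <= b * W by rewrite mulr_ge0.
dlra.
Qed.

Lemma subcritical_tail (g : R) i : 0 < g ->
  tail_nat n (1 - dl) i (Num.truncn (t_n_case1 (fun=> dl) n g)) <= 2000 / g.
Proof.
move=> g0; rewrite tail_natE.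
have [li|_] := boolP (live i); last by rewrite mul0r divr_ge0// ltW.
rewrite mul1r; set L := n%:R / (2 * dl) * ln (dl ^+ 2 * n%:R).
have nd1 : 1 <= n%:R / dl by rewrite ler_pdivlMr// mul1r; dlra.
have L0 : 0 <= L.
  by rewrite mulr_ge0 ?ln_ge0// divr_ge0// mulr_ge0// ltW.
have tE : t_n_case1 (fun=> dl) n g = L + (g + 3) * (n%:R / dl) by [].
(* As [n / dl >= 1], the summand 3 in [t_n_case1] absorbs the truncations to integers. *)
have t0 : L + g * (n%:R / dl) + 3 <= t_n_case1 (fun=> dl) n g by rewrite tE; dlra.
set t := t_n_case1 _ _ _ in t0 *; set m := Num.truncn t; set m1 := Num.truncn L.
have gn0 : 0 < g * (n%:R / dl) by rewrite mulr_gt0//; dlra.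
have /andP[_ tm] : m%:R <= t < m.+1%:R by apply: truncn_itv; dlra.
have /andP[m1L Lm1] : m1%:R <= L < m1.+1%:R by exact: truncn_itv.
rewrite -natr1 in tm; rewrite -natr1 in Lm1.
have m1m : (m1 <= m)%N by rewrite -(ler_nat R); dlra.
rewrite -(subnKC m1m) iterD; set m2 := (m - m1)%N.
have m2g : g * (n%:R / dl) <= m2%:R by rewrite natrB//; dlra.
have m20 : 0 < m2%:R :> R by dlra.
have magn1 j : 0 <= `|magn n j : R| <= 1 by rewrite normr_ge0 magn_norm_le1.
have f0 x : 0 <= x -> 0 <= f x.
  move=> x0; apply: addr_ge0; rewrite mulr_ge0 ?expc_ge0 ?sat_ge0//.
    by rewrite mulr_ge0//; dlra.
  by apply: mulr_ge0; [dlra|exact: mulr_ge0].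
(* Here [182 = 90 * 2 + 2], by [expc_le_sat], and the division by [m2] is Markov's inequality for
   the last [m2] steps. The first [m1] steps then contract [sat]. *)
pose K := n%:R / dl * (182 * k) / m2%:R.
have hit j : live j -> iter m2 Q (fun=> 1) j <= K * sat R a `|magn n j|.
  move=> lj; have /andP[w0 w1] := magn1 j.
  rewrite /K mulrAC ler_pdivlMr// mulrC.
  have := iter_killed_hitting _ _ (1 - dl) n0 m2 (fun j => f `|magn n j|) _ lj.
  move=> /(_ (fun j _ => f0 _ (normr_ge0 _))) h.
  apply: le_trans (h _) _ => [l ll|].
    apply: (le_trans (killed_radial_le _ _ _ n0 _ _ f0 ll)).
    have /andP[_ w1'] := magn1 l.
    by rewrite subcritical_hitting_step// alive_ge.
  rewrite /f; have := expc_le_sat _ w0; set e := expc _ _ _; set s := sat _ _ _ => es.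
  have : n%:R / dl * 90 * e <= n%:R / dl * 90 * (2 * k * s).
    by rewrite ler_wpM2l// mulr_ge0//; dlra.
  dlra.
have dn1 : dl / n%:R <= 1 by rewrite ler_pdivrMr//; dlra.
have dn0 : 0 <= dl / n%:R by rewrite divr_ge0// ltW.
have l0 : 0 <= 1 - dl / n%:R by dlra.
have K0 : 0 <= K by apply: divr_ge0 => //; apply: mulr_ge0; [dlra|exact: mulr_ge0].
apply: (le_trans (iter_killed_le _ _ _ n0 m1 _ _ _ li hit)).
rewrite iter_killedZ//.
have con : iter m1 Q (fun j => sat R a `|magn n j|) i <=
    (1 - dl / n%:R) ^+ m1 * sat R a `|magn n i|.
  apply: iter_killed_contract => // j lj; have /andP[_ w1] := magn1 j.
  apply: (le_trans (killed_radial_le _ _ _ n0 _ _ _ lj)); last first.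
    by rewrite subcritical_sat_step// alive_ge.
  exact: sat_ge0.
pose r := Num.sqrt dl; pose v := Num.sqrt n%:R : R.
have r0 : 0 < r by rewrite sqrtr_gt0.
have v0 : 0 < v by rewrite sqrtr_gt0.
have rE : r ^+ 2 = dl by rewrite sqr_sqrtr// ltW.
have vE : v ^+ 2 = n%:R by rewrite sqr_sqrtr// ltW.
(* After time [L] the factor would be [1 / (dl * sqrt n)]; truncating [L] to [m1] costs at most
   [exp (dl / n) <= 3]. *)
have pow : (1 - dl / n%:R) ^+ m1 <= 3 / (dl * v).
  have dv0 : 0 < dl * v by rewrite mulr_gt0.
  apply: (@le_trans _ _ (expR (dl / n%:R - ln (dl * v)))); last first.
    rewrite expRD expRN lnK ?posrE// ler_wpM2r ?invr_ge0 ?(ltW dv0)//.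
    by rewrite expR_le3// dn0.
  apply: (@le_trans _ _ (expR (- (dl / n%:R)) ^+ m1)).
    by rewrite lerXn2r ?nnegrE ?expR_ge0// expR_ge1Dx.
  rewrite -expRM_natr ler_expR.
  have LE : dl / n%:R * L = ln (dl * v).
    rewrite /L -vE -exprMn lnXn// mulr2n; field.
    by rewrite !lt0r_neq0.
  have : dl / n%:R * L <= dl / n%:R * (m1%:R + 1) by rewrite ler_wpM2l// ltW.
  by rewrite LE mulrDr mulr1 mulNr; dlra.
have /andP[wi0 wi1] := magn1 i.
have sat3 : sat R a `|magn n i| <= 3 * r by exact: sat_le_sqrt.
have : iter m1 Q (fun j => sat R a `|magn n j|) i <= 3 / (dl * v) * (3 * r).
  by apply: (le_trans con); rewrite ler_pM ?exprn_ge0 ?sat_ge0.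
move=> /(ler_wpM2l K0) => h; apply: (le_trans h).
(* The choice of [L] makes all powers of [k], [dl] and [n] cancel down to [n / dl];
   [1638 = 182 * 9]. *)
have -> : K * (3 / (dl * v) * (3 * r)) = 1638 * (n%:R / dl) / m2%:R.
  have kk : k = r * v by rewrite /k /r /v sqrtrM// ltW.
  rewrite /K kk -rE; field; rewrite !lt0r_neq0//.
rewrite ler_pdivrMr// mulrAC ler_pdivlMr//.
dlra.
Qed.

End subcritical.

(** * The case [delta^2 n = O(1)], at the scale [1 / q = n^(-1/4)], where [dl] may have either
    sign *)

Section critical.
Variables (R : realType) (n : nat) (D dl q : R).
Hypothesis D1 : 1 <= D.
Hypothesis nq : n%:R = q ^+ 4.
Hypothesis qD : 400 * D ^+ 2 <= q.
Hypothesis dlq : `|dl| * q ^+ 2 <= D.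
Implicit Types (w : R) (i j : 'I_n.+1).

Local Notation d := (2 / n%:R : R).
Local Notation b := (1 - dl).
Local Notation pd := (p_down n b).
Local Notation pu := (p_up n b).
Local Notation step := (radial_step R n b).
Local Notation Q := (killed R n b).
Local Notation live i := (alive R n i).
(** [M] is such that half of the noise gain, [M / 40 = 5 * D^2], outweighs the worst outward drift
    in [w * q < 10 * D]. [B] then makes [expc] gain [800 * D + 1] there. *)
Let M : R := 200 * D ^+ 2.
Let B : R := (800 * D + 1) * 60 / M ^+ 2 * expR (M * (10 * D)).

Let D2 : D <= D ^+ 2. Proof. by move: D1; nra. Qed.
Let D0 : 0 < D. Proof. by move: D1; lra. Qed.
Let M0 : 0 < M. Proof. by rewrite mulr_gt0// exprn_gt0. Qed.
Let q4 : 4 * D <= q. Proof. by move: qD D2 D0; lra. Qed.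
Let q1 : 1 <= q. Proof. by move: q4 D1; lra. Qed.
Let q0 : 0 < q. Proof. by move: q1; lra. Qed.
Let n0R : 0 < n%:R :> R. Proof. by rewrite nq exprn_gt0. Qed.
Let n0 : (0 < n)%N. Proof. by move: n0R; rewrite ltr0n. Qed.
Let d0 : 0 < d. Proof. by rewrite divr_gt0. Qed.
Let a0 : 0 <= q ^+ 2. Proof. exact: sqr_ge0. Qed.
Let k0 : 0 <= M * q. Proof. by rewrite mulr_ge0// ltW. Qed.
Let B0 : 0 < B.
Proof.
rewrite mulr_gt0 ?expR_gt0// divr_gt0 ?exprn_gt0// mulr_gt0//.
by move: D0; lra.
Qed.

Let p w : R := Num.sqrt (1 + q ^+ 2 * w ^+ 2).

Let pE w : p w ^+ 2 = 1 + (w * q) ^+ 2.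
Proof. by rewrite sqr_sqrtr ?exprMn 1?mulrC// addr_ge0// mulr_ge0// sqr_ge0. Qed.

Let p_ge0 w : 0 <= p w. Proof. exact: sqrtr_ge0. Qed.

Let p_ge1 w : 1 <= p w.
Proof.
by rewrite -(@ler_pXn2r _ 2)// ?nnegrE// pE expr1n lerDl sqr_ge0.
Qed.

Let dl_small : `|dl| <= 1 / 4.
Proof.
have h : `|dl| * (4 * D) <= D.
  apply: le_trans dlq; apply: ler_wpM2l => //; apply: (le_trans q4).
  by move: q1; nra.
rewrite -(ler_pM2r D0); lra.
Qed.

(** The powers of [q] express the bound in [x = w * q]. The linear term may point outward but is at
    most [D * x]; the cubic one has coefficient at least [(3/4)^3 * 5/28 >= 1/50]. *)
Lemma critical_drift w : 0 <= w -> w <= 1 ->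
  w * q * ((w * q) ^+ 2 / 50 - D) <= 2 * (pd w - pu w) * q ^+ 3.
Proof.
move=> w0 w1; move: dl_small; rewrite ler_norml => /andP[dlm dlM].
have b0 : 0 <= b by lra.
have bw0 : 0 <= b * w by rewrite mulr_ge0.
have bw1 : b * w <= 5 / 4.
  by apply: (@le_trans _ _ (b * 1)); [exact: ler_wpM2l|lra].
have bw2 : b * w < 2 by lra.
have q30 : 0 <= q ^+ 3 by rewrite exprn_ge0// ltW.
apply: le_trans (ler_wpM2r q30 (drift_ge _ _ _ b0 _ w0 bw2)).
set z := (b * w) ^+ 2 / 4.
have z0 : 0 <= z by rewrite divr_ge0// sqr_ge0.
have z1 : z <= 2 / 5.
  have : (b * w) ^+ 2 <= (5 / 4) ^+ 2 by rewrite lerXn2r// nnegrE; lra.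
  by rewrite /z; lra.
have -> : w * q * ((w * q) ^+ 2 / 50 - D) = w * (w ^+ 2 / 50 - D / q ^+ 2) * q ^+ 3.
  by field; exact: lt0r_neq0.
apply: ler_wpM2r => //; apply: ler_wpM2l => //.
have -> : 1 - b / (1 + z) = dl + b * z * (1 + z)^-1.
  by field; apply: lt0r_neq0; lra.
have hdl : - (D / q ^+ 2) <= dl.
  have : `|dl| <= D / q ^+ 2 by rewrite ler_pdivlMr ?exprn_gt0.
  by rewrite ler_norml => /andP[].
suff : w ^+ 2 / 50 <= b * z * (1 + z)^-1 by lra.
have z5 : 5 / 7 <= (1 + z)^-1 by rewrite -[leRHS]div1r ler_pdivlMr; lra.
have bz0 : 0 <= b * z by rewrite mulr_ge0.
apply: (@le_trans _ _ (b * z * (5 / 7))); last exact: ler_wpM2l.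
have -> : b * z * (5 / 7) = b ^+ 3 * (5 / 28) * w ^+ 2 by rewrite /z; field.
rewrite [leLHS]mulrC; apply: ler_wpM2r; first exact: sqr_ge0.
have : (3 / 4) ^+ 3 <= b ^+ 3 by rewrite lerXn2r ?nnegrE; lra.
lra.
Qed.

Let f w : R := q ^+ 6 * (800 * q) * sat R (q ^+ 2) w + q ^+ 6 * B * expc R (M * q) w.

Let sat_decr w : d <= w -> w <= 1 ->
  q ^+ 6 * (800 * q) * step (sat R (q ^+ 2)) w <=
  q ^+ 6 * (800 * q) * sat R (q ^+ 2) w - 800 * (w * q * ((w * q) ^+ 2 / 50 - D)) / p w ^+ 3.
Proof.
move=> dw w1; have w0 : 0 <= w := le_trans (ltW d0) dw.
have p0 : 0 < p w := lt_le_trans ltr01 (p_ge1 w).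
have c0 : 0 <= q ^+ 6 * (800 * q) by rewrite ltW// mulr_gt0 ?exprn_gt0// mulr_gt0.
apply: (le_trans (ler_wpM2l c0 (sat_step_le _ _ _ n0 _ _ a0 dw w1))).
rewrite mulrBr lerD2l lerN2 -/(p w).
have -> : q ^+ 6 * (800 * q) * (d * (pd w - pu w) / p w ^+ 3) =
  800 * (2 * (pd w - pu w) * q ^+ 3) / p w ^+ 3.
  by rewrite nq; field; rewrite !lt0r_neq0.
rewrite ler_pM2r ?invr_gt0 ?exprn_gt0// ler_pM2l//.
exact: critical_drift.
Qed.

Let expc_decr w m : d <= w -> w <= 1 -> 0 <= m ->
  m * q ^- 3 <= pd w - pu w + pd w * (M * q * d) ->
  q ^+ 6 * B * step (expc R (M * q)) w <= q ^+ 6 * B * expc R (M * q) w -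
    B * expR (- (M * q * w)) * (2 * M * m / 3).
Proof.
move=> dw w1 m0 mle.
have c0 : 0 <= q ^+ 6 * B by rewrite ltW// mulr_gt0// exprn_gt0.
have kd : M * q * d <= 1.
  rewrite nq (_ : _ * _ = 2 * M / q ^+ 3); last by field; exact: lt0r_neq0.
  rewrite ler_pdivrMr ?exprn_gt0// mul1r.
  apply: (@le_trans _ _ q); first by move: qD; rewrite /M; lra.
  by apply: ler_eXnr => //; exact: q1.
have m0' : 0 <= m * q ^- 3 by rewrite divr_ge0// exprn_ge0// ltW.
apply: (le_trans (ler_wpM2l c0 (expc_step_le _ _ _ n0 _ _ _ k0 kd dw w1 m0' mle))).
rewrite mulrBr lerD2l lerN2 le_eqVlt; apply/orP; left; apply/eqP.
by rewrite nq; field; exact: lt0r_neq0.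
Qed.

(** For [x >= 10 * D] the cubic drift absorbs the linear one, leaving [x^3 / 100]; with [P <= 2 * x]
    the weight 800 makes the loss of [sat] at least 1, while [expc] does not grow. For [x < 10 * D]
    the [sat] part grows by at most [800 * D], and [expc] pays for it. *)
Lemma critical_hitting_step w : d <= w -> w <= 1 -> step f w <= f w - 1.
Proof.
move=> dw w1; have w0 : 0 <= w := le_trans (ltW d0) dw.
rewrite radial_step_lin /f.
have := sat_decr _ dw w1; have := critical_drift _ w0 w1.
have p0 : 0 < p w := lt_le_trans ltr01 (p_ge1 w).
have q30 : 0 < q ^+ 3 by rewrite exprn_gt0.
have p30 : 0 < p w ^+ 3 by rewrite exprn_gt0.
have := dl_small; rewrite ler_norml => /andP[dlm dlM].
have pd40 : 1 / 40 <= pd w by apply: p_down_ge; lra.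
have Mqd : M * q * d = 2 * M * q ^- 3 by rewrite nq; field; exact: lt0r_neq0.
have x0 : 0 <= w * q by rewrite mulr_ge0// ltW.
have kx : M * q * w = M * (w * q) by ring.
have := pE w; have := p_ge1 w; have := p_ge0 w.
move: p0 p30 (expc_decr w); rewrite kx Mqd; set x := w * q in x0 *; set P := p w.
set mu := pd w - pu w.
clearbody x P mu => P0 P30 expcd P0' P1 PE drift sats.
have Mq0 : 0 <= M * q ^- 3 by rewrite divr_ge0// ltW.
have pdM : 1 / 40 * (2 * M * q ^- 3) <= pd w * (2 * M * q ^- 3).
  by apply: ler_wpM2r => //; lra.
have [xD|xD] := leP (10 * D) x.
  have x2 : 100 * D <= x ^+ 2 by move: D2 D0; nra.
  have x1 : x ^+ 2 / 100 <= x ^+ 2 / 50 - D by lra.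
  have xx0 : 0 <= 2 * x by lra.
  have P2x : P <= 2 * x.
    rewrite -(@ler_pXn2r _ 2)// ?nnegrE// PE exprMn.
    by move: D1; lra.
  have dr : 1 / 800 * P ^+ 3 <= x * (x ^+ 2 / 50 - D).
    apply: (@le_trans _ _ (x * (x ^+ 2 / 100))); last exact: ler_wpM2l.
    have : P ^+ 3 <= (2 * x) ^+ 3 by rewrite lerXn2r// nnegrE.
    by rewrite exprMn; lra.
  have mu0 : 0 <= mu.
    have : 0 <= 2 * mu * q ^+ 3.
      by apply: le_trans drift; apply: le_trans dr; lra.
    by rewrite pmulr_lge0//; lra.
  have := expcd 0 dw w1 (lexx 0).
  rewrite mul0r => /(_ _); rewrite mulr0 mul0r mulr0 subr0 => h.
  have : q ^+ 6 * B * step (expc R (M * q)) w <= q ^+ 6 * B * expc R (M * q) w.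
    apply: h; lra.
  have : 1 <= 800 * (x * (x ^+ 2 / 50 - D)) / P ^+ 3 by rewrite ler_pdivlMr//; lra.
  lra.
have Px : x <= P by rewrite -(@ler_pXn2r _ 2)// ?nnegrE// PE; lra.
have dr : - (800 * D) <= 800 * (x * (x ^+ 2 / 50 - D)) / P ^+ 3.
  rewrite ler_pdivlMr//.
  have xP3 : x <= P ^+ 3 by apply: (le_trans Px); exact: ler_eXnr.
  have : D * x <= D * P ^+ 3 by apply: ler_wpM2l => //; exact: ltW.
  have : 0 <= x * (x ^+ 2 / 50) by rewrite mulr_ge0// divr_ge0// sqr_ge0.
  lra.
have m0 : 0 <= M / 40 by rewrite divr_ge0// ltW.
have mle : M / 40 * q ^- 3 <= mu + pd w * (2 * M * q ^- 3).
  suff : - (M / 40 * q ^- 3) <= mu by lra.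
  rewrite -mulNr ler_pdivrMr//.
  have : D * x <= D * (10 * D) by rewrite ler_wpM2l// ltW.
  have : 0 <= x * (x ^+ 2 / 50) by rewrite mulr_ge0// divr_ge0// sqr_ge0.
  rewrite /M; lra.
have := expcd _ dw w1 m0 mle.
suff : 800 * D + 1 <= B * expR (- (M * x)) * (2 * M * (M / 40) / 3) by lra.
have -> : B * expR (- (M * x)) * (2 * M * (M / 40) / 3) =
  (800 * D + 1) * (expR (M * (10 * D)) * expR (- (M * x))).
  by rewrite /B; field; exact: lt0r_neq0.
rewrite -expRD -[leLHS]mulr1 ler_wpM2l//; first by move: D0; lra.
by rewrite -[leLHS]expR0 ler_expR subr_ge0 ler_pM2l// ltW.
Qed.

(** Both [q * sat] and [expc] are at most 1, so the Lyapunov function is [O(q^6)], that is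
    [O(n^(3/2))], from every starting state. *)
Lemma critical_tail m i :
  m%:R * tail_nat n b i m <= q ^+ 6 * (800 + B).
Proof.
have q60 : 0 < q ^+ 6 by rewrite exprn_gt0.
have q6B : 0 < q ^+ 6 * B by rewrite mulr_gt0.
have q68 : 0 < q ^+ 6 * (800 * q) by rewrite mulr_gt0// mulr_gt0.
rewrite tail_natE.
have [li|_] := boolP (live i); last first.
  by rewrite mul0r mulr0 ltW// mulr_gt0//; move: B0; lra.
rewrite mul1r.
have f0 x : 0 <= x -> 0 <= f x.
  by move=> x0; apply: addr_ge0; rewrite mulr_ge0 ?expc_ge0 ?sat_ge0// ltW.
have := iter_killed_hitting _ _ b n0 m (fun j => f `|magn n j|) _ li.
move=> /(_ (fun j _ => f0 _ (normr_ge0 _))) h.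
apply: le_trans (h _) _ => [j lj|].
  apply: (le_trans (killed_radial_le _ _ _ n0 _ _ f0 lj)).
  by apply: critical_hitting_step; [exact: alive_ge|exact: magn_norm_le1].
rewrite /f; set w := `| _ |.
have : q ^+ 6 * B * expc R (M * q) w <= q ^+ 6 * B * 1.
  by apply: ler_wpM2l; [exact: ltW|exact: expc_le1].
have : q * sat R (q ^+ 2) w <= 1.
  have w0 : 0 <= w by exact: normr_ge0.
  have p0 : 0 < p w := lt_le_trans ltr01 (p_ge1 w).
  rewrite /sat -/(p w) mulrA ler_pdivrMr// mul1r.
  rewrite -(@ler_pXn2r _ 2)// ?nnegrE ?(ltW p0)//.
    by rewrite pE [q * w]mulrC; lra.
  by rewrite mulr_ge0// ltW.
move=> /(ler_wpM2l (ltW q60)); lra.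
Qed.

End critical.

(** * Assembly: from [c / gamma] to [c / sqrt gamma], and the choice of constants *)

Lemma tail_nat_le1 (R : realType) (n : nat) (beta : R) i T : (0 < n)%N ->
  tail_nat n beta i T <= 1.
Proof.
move=> n0; rewrite tail_natE.
have [li|_] := boolP (alive R n i); last by rewrite mul0r.
by rewrite mul1r iter_killed_1_le1.
Qed.

(* For g <= 1 the right-hand side is at least 1, hence only g > 1 matters. *)
Lemma le_div_sqrt (R : rcfType) (c g x : R) : 1 <= c -> 0 < g -> x <= 1 -> x <= c / g ->
  x <= c / Num.sqrt g.
Proof.
move=> c1 g0 x1 xc; have s0 : 0 < Num.sqrt g by rewrite sqrtr_gt0.
have sE : Num.sqrt g ^+ 2 = g by rewrite sqr_sqrtr// ltW.
have [g1|g1] := leP g 1.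
  apply: (le_trans x1); rewrite ler_pdivlMr// mul1r; apply: le_trans c1.
  by rewrite -sqrtr1 ler_wsqrtr.
apply: (le_trans xc); rewrite ler_wpM2l//; first by lra.
rewrite lef_pV2 ?posrE// -[leRHS]sE; apply: ler_eXnr => //.
by rewrite -[leLHS]sqrtr1 ler_wsqrtr// ltW.
Qed.

Theorem theorem4p3 (R : realType) (delta : nat -> R)
  (hbeta_pos : forall n : nat, 0 < 1 - delta n)
  (hbeta_up : exists (C : R) (N : nat), forall n : nat, (N <= n)%N ->
      1 - delta n <= 1 + C / Num.sqrt n%:R) :
  ((forall M : R, exists N : nat, forall n : nat, (N <= n)%N ->
        M <= delta n ^+ 2 * n%:R) ->
   exists c : R, 0 < c /\ exists N : nat, forall n : nat, (N <= n)%N ->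
     forall gamma : R, 0 < gamma -> forall s0 : 'I_n.+1,
       tail_prob n (1 - delta n) s0 (t_n_case1 delta n gamma) <= c / Num.sqrt gamma)
  /\
  ((exists (C : R) (N : nat), forall n : nat, (N <= n)%N ->
        delta n ^+ 2 * n%:R <= C) ->
   exists c : R, 0 < c /\ exists N : nat, forall n : nat, (N <= n)%N ->
     forall gamma : R, 0 < gamma -> forall s0 : 'I_n.+1,
       tail_prob n (1 - delta n) s0 (t_n_case2 delta n gamma) <= c / Num.sqrt gamma).
Proof.
split.
  have [C [N1 hC]] := hbeta_up => hM.
  (* A nonpositive [delta n] would satisfy [delta^2 n <= C^2] by [hbeta_up], so this threshold
     forces [delta n > 0]; it also gives [delta^2 n >= 1]. *)
  have [N2 hN2] := hM (C ^+ 2 + 1).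
  exists 2000; split=> //; exists (maxn 4 (maxn N1 N2)) => n.
  rewrite !geq_max => /and3P[n4 nN1 nN2] g g0 i.
  have n0 : 0 < n%:R :> R by rewrite ltr0n; exact: leq_trans n4.
  have v0 : 0 < Num.sqrt n%:R :> R by rewrite sqrtr_gt0.
  have vE : Num.sqrt n%:R ^+ 2 = n%:R :> R by rewrite sqr_sqrtr// ltW.
  have dn := hN2 _ nN2; have C2 := sqr_ge0 C.
  have dl0 : 0 < delta n.
    rewrite ltNge; apply/negP => dle0.
    have h : - delta n <= C / Num.sqrt n%:R by have := hC _ nN1; lra.
    rewrite ler_pdivlMr// in h.
    have : (- delta n * Num.sqrt n%:R) ^+ 2 <= C ^+ 2.
      have h0 : 0 <= - delta n * Num.sqrt n%:R by rewrite mulr_ge0 ?oppr_ge0// ltW.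
      by rewrite lerXn2r// nnegrE// (le_trans h0).
    by rewrite exprMn sqrrN vE; lra.
  have dl1 : delta n < 1 by have := hbeta_pos n; lra.
  have dln : 1 <= delta n ^+ 2 * n%:R by lra.
  (* The default value 1 at negative times is not met: [t_n_case1] is nonnegative here. *)
  rewrite /tail_prob; case: ltP => [|_].
    rewrite /t_n_case1 ltNge addr_ge0//.
      by rewrite mulr_ge0 ?ln_ge0// divr_ge0 ?ltW// mulr_gt0.
    by rewrite mulr_ge0 ?divr_ge0//; lra.
  apply: le_div_sqrt => //; first by lra.
    by apply: tail_nat_le1; exact: leq_trans n4.
  exact: (subcritical_tail R n (delta n)).
move=> [C [N1 hC]].
(* Then [D >= 1] and [C <= D^2], so [|delta| * sqrt n <= D]. The constant [c] below is [800 + B] for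
   this [D]. *)
pose D : R := 1 + `|C|; have D1 : 1 <= D by rewrite lerDl.
have D0 : 0 < D by lra.
pose M : R := 200 * D ^+ 2.
pose c : R := 800 + (800 * D + 1) * 60 / M ^+ 2 * expR (M * (10 * D)).
have c1 : 1 <= c.
  have : 0 <= (800 * D + 1) * 60 / M ^+ 2 * expR (M * (10 * D)); last by rewrite /c; lra.
  by rewrite mulr_ge0 ?expR_ge0// divr_ge0 ?sqr_ge0// mulr_ge0//; lra.
have M2 : 0 <= 400 * D ^+ 2 by rewrite mulr_ge0// sqr_ge0.
(* Ensures [n >= (400 * D^2)^4], that is [q >= 400 * D^2]. *)
pose N2 := (Num.truncn ((400 * D ^+ 2) ^+ 4)).+1.
exists c; split; first by lra.
exists (maxn N1 N2) => n; rewrite geq_max => /andP[nN1 nN2] g g0 i.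
have nbig : (400 * D ^+ 2) ^+ 4 <= n%:R.
  have /andP[_ /ltW h] := truncn_itv (exprn_ge0 4 M2).
  by apply: (le_trans h); rewrite ler_nat.
have n0 : (0 < n)%N by exact: leq_trans nN2.
have n0R : 0 < n%:R :> R by rewrite ltr0n.
pose q : R := Num.sqrt (Num.sqrt n%:R).
have q0 : 0 < q by rewrite !sqrtr_gt0.
have q2 : q ^+ 2 = Num.sqrt n%:R by rewrite sqr_sqrtr// sqrtr_ge0.
have q4 : n%:R = q ^+ 4 by rewrite (exprM q 2 2) q2 sqr_sqrtr// ltW.
have qD : 400 * D ^+ 2 <= q by rewrite -(@ler_pXn2r _ 4) ?nnegrE ?(ltW q0)// -q4.
have dlq : `|delta n| * q ^+ 2 <= D.
  have dq0 : 0 <= `|delta n| * q ^+ 2 by apply: mulr_ge0 => //; exact: sqr_ge0.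
  rewrite -(@ler_pXn2r _ 2) ?nnegrE ?(ltW D0)//.
  rewrite exprMn real_normK ?num_real// -exprM -q4.
  apply: (le_trans (hC _ nN1)); have := ler_norm C; have := normr_ge0 C.
  by rewrite /D; nra.
set t := t_n_case2 delta n g.
have q61 : 1 <= q ^+ 6.
  apply: exprn_ege1; apply: le_trans qD.
  have : 1 <= D ^+ 2 by rewrite exprn_ege1.
  lra.
(* Here [n * sqrt n = q^6]; the extra 1 makes the truncated time still at least [g * q^6]. *)
have tg : g * q ^+ 6 + 1 <= t.
  rewrite /t /t_n_case2 -q2 {2}q4 -exprD.
  have s0 := sqrtr_ge0 (delta n ^+ 2 * n%:R).
  have gs : 0 <= g * Num.sqrt (delta n ^+ 2 * n%:R) by rewrite mulr_ge0// ltW.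
  have : g * q ^+ 6 + 200 * q ^+ 6 <=
      (200 + 6 * g * (1 + 6 * Num.sqrt (delta n ^+ 2 * n%:R))) * q ^+ 6.
    by rewrite -mulrDl ler_wpM2r ?(le_trans ler01)//; lra.
  lra.
have gq : 0 < g * q ^+ 6 by rewrite mulr_gt0// exprn_gt0.
rewrite /tail_prob -/t; case: ltP => [t0|_]; first by lra.
apply: (@le_div_sqrt R c g) => //; first exact: tail_nat_le1.
have /andP[_ tm] : (Num.truncn t)%:R <= t < (Num.truncn t).+1%:R by apply: truncn_itv; lra.
rewrite -natr1 in tm.
have := critical_tail R n D (delta n) q D1 q4 qD dlq (Num.truncn t) i.
rewrite -/M -/c => h.
have mt : g * q ^+ 6 <= (Num.truncn t)%:R by lra.
have m0 : 0 < (Num.truncn t)%:R :> R by lra.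
have c0 : 0 <= c by lra.
rewrite ler_pdivlMr//.
rewrite mulrC -ler_pdivlMr// in h.
have : tail_nat n (1 - delta n) i (Num.truncn t) * g <= q ^+ 6 * c / (Num.truncn t)%:R * g.
  by rewrite ler_wpM2r// ltW.
move=> /le_trans; apply; rewrite mulrAC ler_pdivrMr//.
have := ler_wpM2l c0 mt; lra.
Qed.
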